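(* Let $X$ be a doubling metric space with doubling constant $N$, let $0<m<s$ and $\Lambda>1$. Then there exists a constant $\delta_0=\delta_0(m,s,N,\Lambda)>0$ satisfying the following: for every $0<\delta<\delta_0$ there is $\varepsilon_0=\varepsilon_0(\delta,m,N)>0$ so that for each measure $\mu$ on $X$ we have $$\limsup_{r\downarrow0}\hom_{\delta,\varepsilon,r}^{\Lambda}(\mu,x)\ge\delta^{-m}$$ for all $0<\varepsilon\le\varepsilon_0$ and for $\mu$-almost all $x\in X$ that satisfy $\overline{\dim}_{\mathrm{loc}}(\mu,x)>s$.
   Context: Let $(X,d)$ be a metric space. $B(x,r)=\{y\in X: d(x,y)\le r\}$ denotes the closed ball; each ball comes with a fixed centre and radius. $X$ is doubling with doubling constant $N\in\mathbb{N}$ if every closed ball $B(x,r)$ can be covered by $N$ balls of radius $r/2$. A measure on $X$ means a nontrivial Borel regular outer measure defined on all subsets of $X$ such that bounded sets have finite measure. The upper local dimension is $\overline{\dim}_{\mathrm{loc}}(\mu,x)=\limsup_{r\downarrow0}\log\mu(B(x,r))/\log r$. A $\delta$-packing of a set $A\subset X$ is a countable collection of pairwise disjoint closed balls of radius $\delta$ with centres in $A$. For $x\in X$, $\delta,\varepsilon,r>0$ and $\Lambda>1$ let $$\hom_{\delta,\varepsilon,r}^{\Lambda}(\mu,x)=\sup\{\#\mathcal{B}: \mathcal{B}\text{ is a }(\delta r)\text{-packing of }B(x,r)\text{ with }\mu(B)>\varepsilon\mu(B(x,\Lambda r))\text{ for all }B\in\mathcal{B}\}.$$ Notation such as $c=c(\cdots)$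 means that the constant depends only on the listed parameters. *)

(* Defs.v *)
From mathcomp Require Import all_boot all_order all_algebra.
From mathcomp Require Import all_classical all_reals all_analysis.

Set Implicit Arguments.
Unset Strict Implicit.
Unset Printing Implicit Defensive.

Import Order.TTheory GRing.Theory Num.Theory.
Import numFieldNormedType.Exports.

Local Open Scope classical_set_scope.
Local Open Scope ring_scope.

Section Defs.
Context {R : realType} {X : metricType R}.
Implicit Types (x : X) (r : R) (A C : set X).

(* In a general metric space this may be strictly larger than the closure
   of the open ball, which is what the library's closed_ball denotes. *)
Definition cball x r : set X := [set y | mdist x y <= r].

(* The centres c need not be distinct, so "N balls" means "at most N balls". *)
Definition doubling (N : nat) : Prop :=
  forall x r, 0 < r -> exists c : 'I_N -> X,
    cball x r `<=` \bigcup_(i in [set: 'I_N]) cball (c i) (r / 2).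

Definition metric_bounded A : Prop :=
  exists D : R, forall x y, A x -> A y -> mdist x y <= D.

Definition borel : set (set X) := <<s [set U : set X | open U] >>.

Definition borel_regular (mu : {outer_measure set X -> \bar R}) : Prop :=
  borel `<=` mu.-caratheodory /\
  forall A, exists B, [/\ borel B, A `<=` B & mu B = mu A].

Definition is_measure (mu : {outer_measure set X -> \bar R}) : Prop :=
  [/\ mu [set: X] <> 0%E,
      borel_regular mu &
      forall A, metric_bounded A -> (mu A < +oo)%E].

Definition ae_outer (mu : {outer_measure set X -> \bar R}) (P : X -> Prop) :=
  mu [set x | ~ P x] = 0%E.

(* lne 0 = -oo, so the quotient is +oo at scales 0 < r < 1 where the ball has
   measure zero. *)
Definition upper_local_dim (mu : {outer_measure set X -> \bar R}) x : \bar R :=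
  limf_esup (fun r : R => lne (mu (cball x r)) * ((ln r)^-1)%:E)%E 0^'+.

(* A packing is encoded by its set C of centres: balls carry their centre, and
   pairwise disjoint balls of radius rho >= 0 have distinct centres, so the
   packing has exactly as many balls as C has points. *)
Definition packing (rho : R) A C : Prop :=
  [/\ C `<=` A, countable C & trivIset C (fun c => cball c rho)].

Definition local_homogeneity (delta eps r Lambda : R)
    (mu : {outer_measure set X -> \bar R}) x : \bar R :=
  ereal_sup [set counting C | C in [set C : set X |
    packing (delta * r) (cball x r) C /\
    forall c, C c ->
      (eps%:E * mu (cball x (Lambda * r)) < mu (cball c (delta * r)))%E]].

End Defs.

Arguments doubling {R} X N.

(* Main.v *)
Require Import Defs.
From mathcomp Require Import all_boot all_order all_algebra.
From mathcomp Require Import all_classical all_reals all_analysis.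
From mathcomp Require Import ring lra.

(** Fix a ball of radius r centred in a set A all of whose points have small
    homogeneity at every small scale.  Call a point of A in this ball heavy if
    its ball of radius delta r has measure above eps times that of the
    Lambda r-ball around the centre, and light otherwise.  Small homogeneity
    bounds the packings by heavy balls, so the heavy points are covered by at
    most M = delta^(-m) balls of radius 2 delta r centred in A; the light ones
    need N^k such balls, where 2^(-k) <= delta (heavy_light_cover).

    Iterating gives, at stage n, a cover by balls of radius
    r_n = r_0 (2 delta)^n indexed by sequences of heavy and light steps.  Each
    light step makes the measure around the point drop by the factor eps while
    the radius goes from (Lambda + 1) r_i to delta r_i.  As Lambda is at most
    of order 1 / delta, such a drop spans two stages, so j light steps
    contribute at least a factor e^j, where eps <= e^2.  If w offsets the
    number of light children, that is N^k w <= 1, then the sum of w^j over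
    stage n is at most (M + 1)^n (weighted_cover).

    Points z with mu(B(z, r_n / 2)) <= K r_n^s then obey two bounds at once,
    K r_n^s and T e^j.  Interpolating them with the weight tau = (s - m) / (2 s)
    and putting w = e^tau, the points of this kind have total measure at most
    a constant times ((2 delta)^((s + m) / 2) (M + 1))^n.  The base is at most
    1/2 for small delta because (s + m) / 2 > m.  By the Borel-Cantelli
    argument almost every point of A lies in finitely many of these sets
    (frequent_decay_null), whereas a point of upper local dimension above s
    lies in infinitely many (null_of_small_homogeneity).

    The constant e has to make N^k e^tau <= 1 without knowledge of s.  This is
    possible since delta_0 may depend on s: requiring delta <= tau allows
    e = (N^k + 1)^(-1 / delta). *)

Set Implicit Arguments.
Unset Strict Implicit.
Unset Printing Implicit Defensive.

Import Order.TTheory GRing.Theory Num.Theory.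
Import numFieldNormedType.Exports.

Local Open Scope classical_set_scope.
Local Open Scope ring_scope.

Lemma exists_le_exp2 (R : realType) (x : R) : exists n, x <= 2 ^+ n.
Proof.
exists (Num.Def.truncn x).+1; apply/ltW/(lt_le_trans (truncnS_gt _)).
by rewrite -natrX ler_nat ltnW// ltn_expl.
Qed.

(** * Covers and packings in doubling spaces *)

Section Covers.
Context {R : realType} {X : metricType R}.
Implicit Types (x y z : X) (r : R) (A L : set X).

Lemma cball_sub x y r r' : mdist x y + r <= r' -> cball y r `<=` cball x r'.
Proof.
move=> h z; rewrite /cball/= => yz.
by apply: le_trans (metric_triangle x y z) _; apply: le_trans h; rewrite lerD2l.
Qed.

Lemma doubling_iter N k x r : doubling X N -> 0 < r ->
  exists s : seq X, (size s <= N ^ k)%N /\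
    forall y, cball x r y -> exists2 c, c \in s & mdist c y <= r / 2 ^+ k.
Proof.
move=> dX r0; elim: k => [|k [s [ss sP]]].
  exists [:: x]; split=> [|y]; first by rewrite expn0.
  by exists x; rewrite ?mem_head// expr0 divr1.
have rk0 : 0 < r / 2 ^+ k by rewrite divr_gt0// exprn_gt0.
have /choice[f fP] := fun c => dX c _ rk0.
exists (flatten [seq [seq f c i | i <- enum 'I_N] | c <- s]); split.
  rewrite size_flatten /shape -map_comp.
  rewrite (@eq_map _ _ _ (fun=> N)); last first.
    by move=> c /=; rewrite size_map size_enum_ord.
  rewrite (_ : map _ _ = nseq (size s) N) ?sumn_nseq ?expnS ?leq_mul2l ?ss ?orbT//.
  by elim: (s) => //= _ t ->.
move=> y /sP[c cs /fP[i _ cy]]; exists (f c i).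
  apply/flattenP; exists [seq f c i | i <- enum 'I_N]; first exact: map_f.
  by rewrite map_f// mem_enum.
by rewrite exprSr invfM mulrA.
Qed.

(** Moving the centres of a cover into the covered set doubles the radius. *)
Lemma doubling_cover_centered N k x r L : doubling X N -> 0 < r ->
  L `<=` cball x r ->
  exists s : seq X, [/\ (size s <= N ^ k)%N, forall c, c \in s -> L c &
    forall y, L y -> exists2 c, c \in s & mdist c y <= 2 * (r / 2 ^+ k)].
Proof.
move=> dX r0 Lx; have [s [ss sP]] := doubling_iter k x dX r0.
pose P c y := L y /\ mdist c y <= r / 2 ^+ k.
have /choice[f fP] : forall c, exists o : option X,
    if o is Some y then P c y else forall y, ~ P c y.
  move=> c; have [[y Py]|nP] := pselect (exists y, P c y); first by exists (Some y).
  by exists None => y Py; apply: nP; exists y.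
exists (pmap f s); split.
- rewrite size_pmap; exact: leq_trans (count_size _ _) ss.
- by move=> c; rewrite mem_pmap => /mapP[d _ /esym fd]; have := fP d; rewrite fd => -[].
- move=> y Ly; have [c cs cy] := sP _ (Lx _ Ly).
  have := fP c; case fc : (f c) => [d|] => [[Ld cd]|/(_ y)]; last by case.
  exists d; first by rewrite mem_pmap -fc map_f.
  have := metric_triangle d c y; rewrite (metric_sym d c) => h.
  by rewrite mulr2n mulrDl mul1r (le_trans h)// lerD.
Qed.

(** A packing with the largest possible number of balls leaves no room for a
    further ball, so its balls of twice the radius cover. *)
Lemma max_packing_cover (M r : R) A : 0 <= r ->
  (forall C, packing r A C -> (counting C < M%:E)%E) ->
  exists s : seq X, [/\ (size s)%:R <= M, forall c, c \in s -> A c &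
    forall y, A y -> exists2 c, c \in s & mdist c y <= 2 * r].
Proof.
move=> r0 AM.
pose P n := `[< exists s : seq X, [/\ size s = n, uniq s & packing r A [set` s]] >].
have PM n : P n -> n%:R < M.
  move=> /asboolP[s [<- us /AM]]; rewrite /counting asboolT ?lte_fin; last exact: finite_seq.
  suff -> : fset_set [set` s] = finmap.seq_fset tt s by rewrite finmap.size_seq_fset undup_id.
  apply/finmap.fsetP => c; rewrite in_fset_set; last exact: finite_seq.
  by rewrite finmap.seq_fsetE; apply/idP/idP; rewrite inE.
have P0 : exists n, P n.
  exists 0%N; apply/asboolP; exists [::]; split => //; split.
  - by move=> c.
  - exact: finite_set_countable (finite_seq _).
  - by move=> c d.
have Pb n : P n -> (n <= Num.Def.truncn M)%N.
  by move=> /PM nM; rewrite truncn_ge_nat ?(ltW nM)// (le_trans _ (ltW nM)).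
case: (ex_maxnP P0 Pb) => n Pn nmax; have nM := PM _ Pn.
have /asboolP[s [sn us [sA _ ts]]] := Pn.
exists s; split=> [||y Ay]; [by rewrite sn ltW|by move=> c cs; exact: sA|].
apply: contrapT => far.
have {}far c : c \in s -> cball c r `&` cball y r = set0.
  move=> cs; rewrite -subset0 => z [cz yz]; apply: far; exists c => //.
  have := metric_triangle c z y; rewrite (metric_sym z y) => /le_trans; apply.
  by rewrite mulr2n mulrDl mul1r lerD.
have ys : y \notin s.
  apply/negP => /far; apply/eqP; apply/set0P.
  by exists y; split; rewrite /cball/= mdistxx.
suff : P n.+1 by move=> /nmax; rewrite ltnn.
apply/asboolP; exists (y :: s); split; rewrite /= ?sn ?ys//; split.
- by move=> c /=; rewrite inE => /predU1P[->//|/sA].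
- exact: finite_set_countable (finite_seq _).
- move=> c d /=; rewrite !inE => /predU1P[->|cs] /predU1P[->|ds] //.
  + by rewrite setIC far// => -[].
  + by rewrite far// => -[].
  + exact: ts.
Qed.

End Covers.

(** * Heavy and light steps *)

Section Homogeneity.
Context {R : realType} {X : metricType R}.
Variable mu : {outer_measure set X -> \bar R}.
Implicit Types (x y z : X) (r : R) (A : set X).

(** The left alternative collects the heavy points, covered by doubling the
    balls of a maximal packing; the right one the light points, for which only
    the doubling of the space is available. *)
Lemma heavy_light_cover N k A x r (delta eps Lambda M : R) :
    doubling X N -> 0 < r -> 0 < delta -> (2 ^+ k)^-1 <= delta ->
    (local_homogeneity delta eps r Lambda mu x < M%:E)%E ->
  exists sH sL : seq X,
    [/\ (size sH)%:R <= M, (size sL <= N ^ k)%N,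
        forall c, c \in sH ++ sL -> A c &
        forall z, A z -> cball x r z ->
          (exists2 c, c \in sH & mdist c z <= 2 * delta * r) \/
          ((exists2 c, c \in sL & mdist c z <= 2 * delta * r) /\
           (mu (cball z (delta * r)) <= eps%:E * mu (cball x (Lambda * r)))%E)].
Proof.
move=> dX r0 d0 kd homM.
pose heavy c := (eps%:E * mu (cball x (Lambda * r)) < mu (cball c (delta * r)))%E.
pose S := A `&` cball x r.
have dr0 : 0 <= delta * r by rewrite ltW// mulr_gt0.
have [sH [sHM sHA sHP]] : exists s : seq X, [/\ (size s)%:R <= M,
    forall c, c \in s -> (S `&` heavy) c &
    forall y, (S `&` heavy) y -> exists2 c, c \in s & mdist c y <= 2 * (delta * r)].
  apply: max_packing_cover => // C [CS Cc Ct]; apply: le_lt_trans homM.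
  apply: ereal_sup_ubound; exists C => //; split; last by move=> c /CS[].
  by split=> // c /CS[[]].
have [||sL [sLN sLA sLP]] := @doubling_cover_centered _ _ N k x r (S `\` heavy) dX.
- by [].
- by move=> z [[]].
exists sH, sL; split=> //.
  by move=> c; rewrite mem_cat => /orP[/sHA[[]]|/sLA[[]]].
move=> z Az xz; have [hz|hz] := pselect (heavy z).
  by left; have [|c cs cz] := sHP z; [|exists c => //; rewrite -mulrA].
right; split; last by rewrite leNgt; apply/negP.
have [|c cs cz] := sLP z; first by [].
exists c => //; apply: le_trans cz _.
by rewrite -mulrA ler_pM2l// mulrC ler_pM2r.
Qed.

(** An entry (c, j) of t is a ball of stage n reached through j light steps.  A
    light step compares radii two stages apart, so the induction has to carry
    the bound for the current stage together with that of the previous one,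
    whose ball has radius r / (4 delta). *)
Lemma weighted_cover N k A y r0 (delta eps Lambda M e w T : R) :
    doubling X N -> 0 < delta -> (2 ^+ k)^-1 <= delta ->
    1 < Lambda -> 4 * delta * (Lambda + 1) <= 1 ->
    0 < e -> e <= 1 -> 0 <= eps -> eps <= e ^+ 2 -> 0 <= w -> (N ^ k)%:R * w <= 1 ->
    0 <= M -> 0 < r0 ->
    (forall x r, A x -> 0 < r -> r <= r0 ->
      (local_homogeneity delta eps r Lambda mu x < M%:E)%E) ->
    A y -> (mu (cball y (r0 + r0 / (4 * delta))) <= T%:E)%E ->
  forall n, exists t : seq (X * nat),
    [/\ \sum_(p <- t) w ^+ p.2 <= (M + 1) ^+ n,
        forall p, p \in t -> A p.1 &
        forall z, A z -> cball y r0 z -> exists2 p, p \in t &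
          let r := r0 * (2 * delta) ^+ n in
          [/\ mdist p.1 z <= r,
              (mu (cball z (r / 2)) <= (e ^+ p.2 * T)%:E)%E &
              (mu (cball z (r / (4 * delta))) <= (e ^+ p.2.-1 * T)%:E)%E]].
Proof.
move=> dX d0 kd L1 dL e0 e1 eps0 epse w0 Nw M0 r00 hA Ay muT.
have T0 : 0 <= T by rewrite -lee_fin (le_trans _ muT)// outer_measure_ge0.
have d2 : 2 * delta <= 1 by nra.
elim=> [|n [t [tM tA tP]]].
  exists [:: (y, 0%N)]; split.
  - by rewrite big_seq1 !expr0.
  - by move=> p; rewrite inE => /eqP->.
  move=> z Az yz; exists (y, 0%N); first by rewrite mem_head.
  rewrite /= !expr0 !mulr1 !mul1r; split => //.
    apply: le_trans muT; apply: le_outer_measure; apply: cball_sub.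
    rewrite lerD// ler_pM2l// lef_pV2// ?posrE; nra.
  apply: le_trans muT; apply: le_outer_measure; apply: cball_sub.
  by rewrite lerD2r.
set r := r0 * (2 * delta) ^+ n in tP *.
have r_gt0 : 0 < r by rewrite mulr_gt0// exprn_gt0//; nra.
have rr0 : r <= r0 by rewrite ger_pMr// exprn_ile1//; nra.
have /choice[s sP] : forall c, exists s : seq X * seq X, A c ->
    [/\ (size s.1)%:R <= M, (size s.2 <= N ^ k)%N,
        forall d, d \in s.1 ++ s.2 -> A d &
        forall z, A z -> cball c r z ->
          (exists2 d, d \in s.1 & mdist d z <= 2 * delta * r) \/
          ((exists2 d, d \in s.2 & mdist d z <= 2 * delta * r) /\
           (mu (cball z (delta * r)) <= eps%:E * mu (cball c (Lambda * r)))%E)].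
  move=> c; have [Ac|nAc] := pselect (A c); last by exists ([::], [::]).
  have [//|sH [sL ?]] := @heavy_light_cover N k A c r delta eps Lambda M dX r_gt0 d0 kd.
    exact: hA.
  by exists (sH, sL).
pose f p := [seq (c, p.2) | c <- (s p.1).1] ++ [seq (c, p.2.+1) | c <- (s p.1).2].
exists (flatten [seq f p | p <- t]); split.
- rewrite big_flatten big_map exprS.
  apply: le_trans (ler_wpM2l _ tM); last by rewrite addr_ge0.
  rewrite mulr_sumr big_seq [leRHS]big_seq; apply: ler_sum => p /tA /sP[sM sN _ _].
  rewrite big_cat !big_map /= !big_const_seq !count_predT !iter_addr_0.
  rewrite mulrDl mul1r -mulr_natl lerD//.
    by rewrite ler_wpM2r// exprn_ge0.
  rewrite exprSr -mulr_natl [X in _ * X]mulrC mulrA ler_piMl ?exprn_ge0//.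
  by apply: le_trans Nw; rewrite ler_wpM2r// ler_nat.
- move=> q /flattenP[_ /mapP[p /tA /sP[_ _ sA _] ->]].
  by rewrite mem_cat => /orP[] /mapP[c cs ->] /=; apply: sA; rewrite mem_cat cs ?orbT.
move=> z Az yz; have [p pt [pz mu1 mu2]] := tP z Az yz.
have [_ _ _ /(_ z Az pz) pP] := sP _ (tA _ pt).
have rS : r0 * (2 * delta) ^+ n.+1 = 2 * delta * r by rewrite exprS mulrCA.
rewrite /=; have -> : r0 * (2 * delta) ^+ n.+1 / 2 = delta * r by rewrite rS; field.
have -> : r0 * (2 * delta) ^+ n.+1 / (4 * delta) = r / 2.
  by rewrite rS; field; rewrite gt_eqF.
rewrite rS.
have mono : (mu (cball z (delta * r)) <= mu (cball z (r / 2)))%E.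
  by apply: le_outer_measure; apply: cball_sub; rewrite mdistxx add0r; nra.
have eS j : e ^+ j.+1 * T <= e ^+ j * T by rewrite ler_wpM2r// exprSr ler_piMr// exprn_ge0 // ltW.
case: pP => [[c cs cz]|[[c cs cz] light]].
  exists (c, p.2).
    apply/flattenP; exists (f p); first exact: map_f.
    by rewrite mem_cat; apply/orP; left; apply/mapP; exists c.
  split => //=; first exact: le_trans mu1.
  apply: le_trans mu1 _; rewrite lee_fin.
  by case: (p.2) => //= j.
exists (c, p.2.+1).
  apply/flattenP; exists (f p); first exact: map_f.
  by rewrite mem_cat; apply/orP; right; apply/mapP; exists c.
split => //=.
(* The ball of the light comparison fits into the ball of the previous stage,
   since 4 * delta * (Lambda + 1) <= 1. *)
have le1 : (mu (cball p.1 (Lambda * r)) <= (e ^+ p.2.-1 * T)%:E)%E.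
  apply: le_trans mu2; apply: le_outer_measure; apply: cball_sub.
  rewrite metric_sym (le_trans (lerD pz (lexx _)))//.
  rewrite ler_pdivlMr ?mulr_gt0//; nra.
apply: le_trans light _; apply: le_trans (lee_wpmul2l _ le1) _; first by rewrite lee_fin.
rewrite -EFinM lee_fin mulrA ler_wpM2r//.
apply: le_trans (ler_wpM2r (exprn_ge0 _ (ltW e0)) epse) _.
rewrite -exprD; case: (p.2) => [|j] /=; last by rewrite lexx.
by rewrite addn0 exprS ler_piMr// ltW.
Qed.

End Homogeneity.

(** * Null sets of an outer measure *)

Section OuterMeasure.
Context {R : realType} {T : Type}.
Variable mu : {outer_measure set T -> \bar R}.

Lemma outer_measure_cover_seq (I : eqType) (s : seq I) (G : I -> set T) F :
  (forall z, F z -> exists2 i, i \in s & G i z) ->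
  (mu F <= \sum_(i <- s) mu (G i))%E.
Proof.
elim: s F => [|i s IH] F Fs.
  rewrite big_nil (_ : F = set0) ?outer_measure0//.
  by rewrite -subset0 => z /Fs[].
rewrite big_cons.
have /le_outer_measure/le_trans : F `<=` G i `|` (F `\` G i).
  by move=> z Fz; have [Gz|Gz] := pselect (G i z); [left|right].
apply; apply: le_trans (outer_measureU2 _ _ _) _; apply: leeD => //.
apply: IH => z [/Fs[j]]; rewrite inE => /predU1P[->//|js Gj _].
by exists j.
Qed.

Lemma outer_measure_bigcup_null (G : (set T)^nat) :
  (forall n, mu (G n) = 0%E) -> mu (\bigcup_n G n) = 0%E.
Proof.
move=> G0; apply/eqP; rewrite eq_le outer_measure_ge0 andbT.
apply: le_trans (outer_measure_sigma_subadditive _ _) _.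
by rewrite eseries0// => n _ _; exact: G0.
Qed.

Lemma borel_cantelli_geometric (E : (set T)^nat) (C : R) F : 0 <= C ->
  (forall n, mu (E n) <= (C / 2 ^+ n)%:E)%E ->
  (forall z, F z -> forall k, exists2 n, (k <= n)%N & E n z) ->
  mu F = 0%E.
Proof.
move=> C0 EC FE; apply/eqP; rewrite eq_le outer_measure_ge0 andbT.
have tail k : (mu F <= (C * 2 / 2 ^+ k)%:E)%E.
  have /le_outer_measure/le_trans : F `<=` \bigcup_i E (k + i)%N.
    move=> z /FE /(_ k)[n kn En]; exists (n - k)%N => //.
    by rewrite subnKC.
  apply; apply: le_trans (outer_measure_sigma_subadditive _ _) _.
  apply: le_trans (epsilon_trick0 xpredT _); last first.
    by rewrite divr_ge0 ?mulr_ge0// exprn_ge0.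
  apply: lee_nneseries => [i _ _|i _]; first exact: outer_measure_ge0.
  apply: le_trans (EC _) _; rewrite lee_fin le_eqVlt; apply/orP; left; apply/eqP.
  rewrite natrX exprD exprS; field.
  by rewrite !expf_neq0.
apply/lee_addgt0Pr => eps eps0; rewrite add0e.
have [k Ck] := exists_le_exp2 (C * 2 / eps).
by apply: le_trans (tail k) _; rewrite lee_fin ler_pdivrMr ?exprn_gt0// [leRHS]mulrC -ler_pdivrMr.
Qed.

End OuterMeasure.

(** * Points where the measure decays fast infinitely often *)

Section Decay.
Context {R : realType} {X : metricType R}.
Variable mu : {outer_measure set X -> \bar R}.
Implicit Types (x y z : X) (r : R) (A : set X).

Lemma measure_le_of_small_balls N x r F (v : R) : doubling X N -> 0 < r ->
  0 <= v -> F `<=` cball x r -> (forall z, F z -> (mu (cball z (r / 2)) <= v%:E)%E) ->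
  (mu F <= ((N ^ 2)%:R * v)%:E)%E.
Proof.
move=> dX r0 v0 Fx Fv.
have [s [sN sF sP]] := doubling_cover_centered 2 dX r0 Fx.
have : (mu F <= \sum_(c <- s) mu (cball c (r / 2)))%E.
  apply: outer_measure_cover_seq => z /sP[c cs cz]; exists c => //.
  by rewrite /cball/= (le_trans cz)// expr2; lra.
move=> /le_trans; apply.
apply: (@le_trans _ _ (\sum_(c <- s) v%:E)%E).
  by rewrite big_seq [leRHS]big_seq; apply: lee_sum => c /sF /Fv.
rewrite sumEFin lee_fin big_const_seq count_predT iter_addr_0 -[leLHS]mulr_natl.
by rewrite ler_wpM2r// ler_nat.
Qed.

(** Interpolation turns two bounds for the same ball into a product, which can
    be summed over the cover. *)
Lemma min_le_weighted_geomean (a b tau : R) : 0 <= a -> 0 <= b ->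
  0 <= tau -> tau <= 1 -> Num.min a b <= a `^ (1 - tau) * b `^ tau.
Proof.
move=> a0 b0 t0 t1.
have t1' : 0 <= 1 - tau by rewrite subr_ge0.
have E (c : R) : 0 <= c -> c = c `^ (1 - tau) * c `^ tau.
  by move=> c0; rewrite -powRD subrK ?oner_eq0// powRr1.
case: (leP a b) => ab.
  by rewrite {1}(E a)// ler_wpM2l ?powR_ge0// ge0_ler_powR.
by rewrite {1}(E b)// ler_wpM2r ?powR_ge0// ge0_ler_powR// ltW.
Qed.

Lemma powRX (x a : R) n : 0 <= x -> (x ^+ n) `^ a = (x `^ a) ^+ n.
Proof. by move=> x0; rewrite -!powR_mulrn ?powR_ge0// powRAC. Qed.

(** The weight of the cover is taken to be w = e^tau, so that the factor
    (e^j T)^tau of the interpolated bound is exactly what weighted_cover sums. *)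
Lemma frequent_decay_null N k A y r0 (delta eps Lambda M e tau s K T : R) :
    doubling X N -> 0 < delta -> (2 ^+ k)^-1 <= delta ->
    1 < Lambda -> 4 * delta * (Lambda + 1) <= 1 ->
    0 < e -> e <= 1 -> 0 <= eps -> eps <= e ^+ 2 ->
    0 <= tau -> tau <= 1 -> (N ^ k)%:R * e `^ tau <= 1 ->
    0 <= M -> (2 * delta) `^ (s * (1 - tau)) * (M + 1) <= 2^-1 ->
    0 < r0 -> 0 <= K ->
    (forall x r, A x -> 0 < r -> r <= r0 ->
      (local_homogeneity delta eps r Lambda mu x < M%:E)%E) ->
    A y -> (mu (cball y (r0 + r0 / (4 * delta))) <= T%:E)%E ->
  mu [set z | [/\ A z, cball y r0 z & forall l, exists2 n, (l <= n)%N &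
        let r := r0 * (2 * delta) ^+ n in
        (mu (cball z (r / 2)) <= (K * r `^ s)%:E)%E]] = 0%E.
Proof.
move=> dX d0 kd L1 dL e0 e1 eps0 epse t0 t1 Nw M0 small r00 K0 hA Ay muT.
have T0 : 0 <= T by rewrite -lee_fin (le_trans _ muT)// outer_measure_ge0.
have cover := weighted_cover dX d0 kd L1 dL e0 e1 eps0 epse (powR_ge0 _ _) Nw
  M0 r00 hA Ay muT.
pose r n := r0 * (2 * delta) ^+ n.
have r_gt0 n : 0 < r n by rewrite mulr_gt0// exprn_gt0//; nra.
pose E n := [set z | [/\ A z, cball y r0 z &
  (mu (cball z (r n / 2)) <= (K * r n `^ s)%:E)%E]].
pose G := (K * r0 `^ s) `^ (1 - tau) * T `^ tau.
have G0 : 0 <= G by rewrite mulr_ge0 ?powR_ge0.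
apply: (@borel_cantelli_geometric _ _ _ E ((N ^ 2)%:R * G)).
- by rewrite mulr_ge0.
- move=> n; have [t [tM tA tP]] := cover n.
  pose a := K * r n `^ s; pose b (p : X * nat) := e ^+ p.2 * T.
  have a0 : 0 <= a by rewrite mulr_ge0 ?powR_ge0.
  have b0 p : 0 <= b p by rewrite mulr_ge0// exprn_ge0// ltW.
  pose H p := [set z | cball p.1 (r n) z /\
    (mu (cball z (r n / 2)) <= (Num.min a (b p))%:E)%E].
  have muE : (mu (E n) <= \sum_(p <- t) mu (H p))%E.
    apply: outer_measure_cover_seq => z [Az yz muz].
    have [p pt [pz mu1 _]] := tP z Az yz; exists p => //; split => //.
    by rewrite EFin_min le_min muz.
  apply: le_trans muE _.
  have muH p : (mu (H p) <=
      ((N ^ 2)%:R * (G * ((2 * delta) `^ (s * (1 - tau))) ^+ n * (e `^ tau) ^+ p.2))%:E)%E.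
    have m0 : 0 <= Num.min a (b p) by rewrite le_min a0 b0.
    have Hball : H p `<=` cball p.1 (r n) by move=> z [].
    have Hmin z : H p z -> (mu (cball z (r n / 2)) <= (Num.min a (b p))%:E)%E by case.
    apply: le_trans (measure_le_of_small_balls dX (r_gt0 n) m0 Hball Hmin) _.
    rewrite lee_fin ler_wpM2l//.
    apply: le_trans (min_le_weighted_geomean a0 (b0 p) t0 t1) _.
    have d2 : 0 <= 2 * delta by rewrite mulr_ge0// ltW.
    have -> : a `^ (1 - tau) =
        (K * r0 `^ s) `^ (1 - tau) * ((2 * delta) `^ (s * (1 - tau))) ^+ n.
      rewrite /a /r (@powRM _ r0) ?exprn_ge0 ?(ltW r00)// mulrA.
      rewrite powRM ?mulr_ge0 ?powR_ge0 ?exprn_ge0//; congr (_ * _).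
      by rewrite -powRrM powRX.
    have -> : b p `^ tau = (e `^ tau) ^+ p.2 * T `^ tau.
      by rewrite /b powRM ?exprn_ge0 ?(ltW e0)// powRX// ltW.
    by rewrite le_eqVlt; apply/orP; left; apply/eqP; rewrite /G; ring.
  apply: le_trans (lee_sum _ (fun p _ => muH p)) _.
  rewrite sumEFin lee_fin -mulr_sumr -mulr_sumr -[leRHS]mulrA ler_wpM2l// -[leLHS]mulrA ler_wpM2l//.
  rewrite -exprVn.
  apply: le_trans (ler_wpM2l _ tM) _; first by rewrite exprn_ge0// powR_ge0.
  by rewrite -exprMn lerXn2r// ?nnegrE ?mulr_ge0 ?powR_ge0 ?addr_ge0.
- move=> z [Az yz zl] l; have [n ln zn] := zl l.
  by exists n.
Qed.

End Decay.

(** * Upper local dimension against small homogeneity *)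

Section LocalNotions.
Context {R : realType} {X : metricType R}.
Variable mu : {outer_measure set X -> \bar R}.
Implicit Types (x y z : X) (r : R) (A : set X).

Lemma at_right0_exists (V : set R) : 0^'+ V ->
  exists2 rho, 0 < rho & forall r, 0 < r -> r < rho -> V r.
Proof.
move=> [rho /= rho0 V_rho]; exists rho => // r r0 r_rho.
by apply: V_rho => //=; rewrite sub0r normrN gtr0_norm.
Qed.

Lemma upper_local_dim_gt_frequently x (s rho : R) : 0 < rho ->
  (s%:E < upper_local_dim mu x)%E ->
  exists r, [/\ 0 < r, r < rho & (mu (cball x r) <= (r `^ s)%:E)%E].
Proof.
move=> rho0; apply: contraPP => no; apply/negP; rewrite -leNgt.
pose rho1 := Num.min rho 1.
have rho10 : 0 < rho1 by rewrite lt_min rho0 ltr01.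
pose V := [set r : R | 0 < r < rho1].
apply: (@le_trans _ _ (ereal_sup [set (lne (mu (cball x r)) * ((ln r)^-1)%:E)%E | r in V])).
  apply: ereal_inf_lbound; exists V => //.
  near=> r; rewrite /V/=; apply/andP; split => //.
apply: ge_ereal_sup => _ [r /andP[r0 +] <-]; rewrite lt_min => /andP[r_rho r1].
have rs0 : 0 < r `^ s by rewrite powR_gt0.
have mu_r : ((r `^ s)%:E <= mu (cball x r))%E.
  by rewrite leNgt; apply/negP => lt_mu; apply: no; exists r; split=> //; exact: ltW.
have lnr : ln r < 0 by rewrite ln_lt0// r0.
have ln_mu : ((s * ln r)%:E <= lne (mu (cball x r)))%E.
  rewrite -ln_powR -lne_EFin// lee_lne// in_itv/= ?leey ?andbT ?lee_fin ?ltW//.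
  by apply: lt_le_trans mu_r; rewrite lte_fin.
rewrite -leeN2 -muleN -EFinN.
apply: le_trans (lee_wpmul2r _ ln_mu); last by rewrite lee_fin oppr_ge0 invr_le0 ltW.
by rewrite -EFinM lee_fin mulrN mulfK// lt_eqF.
Unshelve. all: by end_near. Qed.

Lemma limf_esup_lt_near0 (f : R -> \bar R) (M : \bar R) :
  (limf_esup f 0^'+ < M)%E ->
  exists2 rho, 0 < rho & forall r, 0 < r -> r < rho -> (f r < M)%E.
Proof.
move=> /ereal_inf_lt[_ [V V0 <-] VM]; have [rho rho0 V_rho] := at_right0_exists V0.
exists rho => // r r0 r_rho; apply: le_lt_trans VM.
by apply: ereal_sup_ubound; exists r => //; exact: V_rho.
Qed.


Lemma metric_bounded_cball x r : metric_bounded (cball x r).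
Proof.
exists (r + r) => y z xy xz; apply: le_trans (metric_triangle y x z) _.
by rewrite metric_sym lerD.
Qed.

(** A radius with mu(B(z, r)) <= r^s is compared with the first stage n for
    which r_n / 2 <= r.  Then r < r_(n-1) / 2 = r_n / (4 delta), so z has fast
    decay at stage n with K = (4 delta)^(-s).  The initial ball of the iteration
    has to be centred in A, hence the recentred cover of the bounded pieces. *)
Lemma null_of_small_homogeneity N k A (rho delta eps Lambda M e tau s : R) :
    doubling X N -> (forall B, metric_bounded B -> (mu B < +oo)%E) ->
    0 < delta -> (2 ^+ k)^-1 <= delta ->
    1 < Lambda -> 4 * delta * (Lambda + 1) <= 1 ->
    0 < e -> e <= 1 -> 0 <= eps -> eps <= e ^+ 2 ->
    0 < s -> 0 <= tau -> tau <= 1 -> (N ^ k)%:R * e `^ tau <= 1 ->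
    0 <= M -> (2 * delta) `^ (s * (1 - tau)) * (M + 1) <= 2^-1 ->
    0 < rho ->
    (forall x r, A x -> 0 < r -> r < rho ->
      (local_homogeneity delta eps r Lambda mu x < M%:E)%E) ->
    (forall x, A x -> (s%:E < upper_local_dim mu x)%E) ->
  mu A = 0%E.
Proof.
move=> dX mufin d0 kd L1 dL e0 e1 eps0 epse s0 t0 t1 Nw M0 small rho0 hA dimA.
pose r0 := rho / 2; have r00 : 0 < r0 by rewrite divr_gt0.
have d4 : 2 * delta <= 2^-1 by nra.
have d2 : 0 < 2 * delta by rewrite mulr_gt0.
have local y : A y -> mu (A `&` cball y r0) = 0%E.
  move=> Ay; pose B := cball y (r0 + r0 / (4 * delta)).
  have muB : (mu B <= (fine (mu B))%:E)%E.
    rewrite fineK// ge0_fin_numE ?outer_measure_ge0//; apply: mufin.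
    exact: metric_bounded_cball.
  have hA' x r : A x -> 0 < r -> r <= r0 ->
      (local_homogeneity delta eps r Lambda mu x < M%:E)%E.
    by move=> Ax r_gt0 rr0; apply: hA => //; rewrite /r0 in rr0; lra.
  have := frequent_decay_null dX d0 kd L1 dL e0 e1 eps0 epse t0 t1 Nw M0 small r00
    (powR_ge0 (4 * delta)^-1 s) hA' Ay muB.
  set F := [set z | _] => F0.
  apply/eqP; rewrite eq_le outer_measure_ge0 andbT -F0; apply: le_outer_measure.
  move=> z [Az yz]; split=> // l.
  have rl0 : 0 < r0 * (2 * delta) ^+ l / 2.
    by rewrite divr_gt0// mulr_gt0// exprn_gt0// mulr_gt0.
  have [r [r_gt0 r_lt mu_r]] := upper_local_dim_gt_frequently rl0 (dimA z Az).
  have ex_n : exists n, r0 * (2 * delta) ^+ n / 2 <= r.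
    have [n n_le] := exists_le_exp2 (r0 / r); exists n.
    apply: (@le_trans _ _ (r0 * (2 * delta) ^+ n)).
      by rewrite ler_pdivrMr// ler_peMr ?ler1n// mulr_ge0 ?exprn_ge0 ?(ltW d2) ?(ltW r00).
    apply: (@le_trans _ _ (r0 * (2^-1) ^+ n)).
      by rewrite ler_pM2l//; apply: lerXn2r; rewrite ?nnegrE ?(ltW d2).
    by rewrite exprVn ler_pdivrMr ?exprn_gt0// mulrC -ler_pdivrMr.
  case: (ex_minnP ex_n) => n rn_le n_min.
  have ln : (l < n)%N.
    rewrite ltnNge; apply/negP => nl; have := le_lt_trans rn_le r_lt.
    rewrite ltNge; apply/negP; rewrite negbK ler_pM2r ?invr_gt0// ler_pM2l//.
    by apply: ler_wiXn2l => //; [rewrite mulr_ge0// ltW|lra].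
  exists n; first exact: ltnW.
  rewrite /=; set rn := r0 * (2 * delta) ^+ n in rn_le *.
  apply: (@le_trans _ _ (mu (cball z r))).
    by apply: le_outer_measure; apply: cball_sub; rewrite mdistxx add0r.
  apply: le_trans mu_r _; rewrite lee_fin.
  have rn0 : 0 <= rn by rewrite mulr_ge0 ?exprn_ge0 ?(ltW d2) ?(ltW r00).
  have k0 : 0 <= (4 * delta)^-1 by rewrite invr_ge0 mulr_ge0// ltW.
  rewrite -(powRM _ k0 rn0).
  apply: ge0_ler_powR; rewrite ?nnegrE ?(ltW s0) ?(ltW r_gt0) ?(mulr_ge0 k0 rn0)//.
  case: n ln n_min @rn rn_le rn0 => // n _ n_min rn _ _.
  have : r < r0 * (2 * delta) ^+ n / 2.
    by rewrite ltNge; apply/negP => /n_min; rewrite ltnn.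
  move=> /ltW/le_trans; apply; rewrite /rn exprS le_eqVlt; apply/orP; left; apply/eqP.
  by field; rewrite gt_eqF.
have [[x0 _]|noX] := pselect (exists x0 : X, True); last first.
  suff -> : A = set0 by rewrite outer_measure0.
  by rewrite -subset0 => x _; apply: noX; exists x.
have -> : A = \bigcup_n (A `&` cball x0 n%:R).
  rewrite -setI_bigcupr setIidl// => z Az.
  exists (Num.Def.truncn (mdist x0 z)).+1 => //.
  by rewrite /cball/=; exact/ltW/truncnS_gt.
apply: outer_measure_bigcup_null => n.
pose R1 : R := n.+1%:R; have R10 : 0 < R1 by rewrite ltr0n.
have [l Rl] := exists_le_exp2 (2 * R1 / r0).
have [|s1 [_ s1A s1P]] := @doubling_cover_centered _ _ N l x0 R1 (A `&` cball x0 n%:R) dX R10.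
  by move=> z [_ zn]; apply: le_trans zn _; rewrite ler_nat.
have le_sum : (mu (A `&` cball x0 n%:R) <= \sum_(c <- s1) mu (A `&` cball c r0))%E.
  apply: outer_measure_cover_seq => z zA; have [c cs cz] := s1P z zA.
  exists c => //; split; first by case: zA.
  apply: le_trans cz _; rewrite mulrA ler_pdivrMr ?exprn_gt0// [leRHS]mulrC.
  by rewrite -ler_pdivrMr.
apply/eqP; rewrite eq_le outer_measure_ge0 andbT; apply: le_trans le_sum _.
by rewrite big_seq big1 // => c /s1A[Ac _]; exact: local.
Qed.

End LocalNotions.

(** * Choice of the constants *)

Section Constants.
Context {R : realType}.
Implicit Types (m s delta : R).

(** The three terms provide, in this order: that a light step spans two stages,
    that delta <= tau, and that the measures of the sets of fast decay are
    summable. *)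
Definition scale_threshold m s Lambda : R :=
  Num.min (4 * (Lambda + 1))^-1
    (Num.min ((s - m) / (2 * s))
      ((2 `^ (- ((s + m) / 2 + 2))) `^ (2 / (s - m)))).

Definition halvings delta : nat := (Num.Def.truncn delta^-1).+1.

(** The base e of the decay per light step.  The exponent - 1 / delta makes
    N^k e^tau <= 1 hold for every tau >= delta. *)
Definition light_decay delta N : R := (N ^ halvings delta).+1%:R `^ (- delta^-1).

Lemma halvingsP delta : 0 < delta -> (2 ^+ halvings delta)^-1 <= delta.
Proof.
move=> d0; rewrite invf_ple ?posrE ?exprn_gt0//.
apply/ltW/(lt_le_trans (truncnS_gt _)).
by rewrite -natrX ler_nat ltnW// ltn_expl.
Qed.

Lemma scale_threshold_gt0 m s Lambda : 0 < m -> m < s -> 1 < Lambda ->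
  0 < scale_threshold m s Lambda.
Proof.
move=> m0 ms L1; rewrite /scale_threshold !lt_min; apply/and3P; split.
- by rewrite invr_gt0; nra.
- by rewrite divr_gt0 ?subr_gt0// mulr_gt0// (lt_trans m0).
- by rewrite !powR_gt0.
Qed.

Lemma scale_thresholdP m s Lambda delta :
  0 < m -> m < s -> 1 < Lambda -> 0 < delta -> delta < scale_threshold m s Lambda ->
  [/\ 4 * delta * (Lambda + 1) <= 1, delta <= (s - m) / (2 * s) &
      (2 * delta) `^ ((s + m) / 2) * (delta `^ (- m) + 1) <= 2^-1].
Proof.
move=> m0 ms L1 d0; rewrite /scale_threshold !lt_min => /and3P[dL dtau dpow].
have dL' : 4 * delta * (Lambda + 1) <= 1.
  have L0 : 0 < 4 * (Lambda + 1) by nra.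
  by move: dL; rewrite -[_^-1]mul1r ltr_pdivlMr// => /ltW; rewrite mulrCA mulrA.
split=> //; first exact: ltW.
have d1 : delta <= 1 by nra.
set a := (s + m) / 2 in dpow *; pose b := (s - m) / 2.
have b0 : 0 < b by rewrite divr_gt0// subr_gt0.
have db : delta `^ b <= 2 `^ (- (a + 2)).
  have -> : 2 `^ (- (a + 2)) = ((2 `^ (- (a + 2))) `^ (2 / (s - m))) `^ b :> R.
    rewrite -powRrM (_ : 2 / (s - m) * b = 1) ?powRr1 ?powR_ge0//.
    by rewrite /b; field; lra.
  by apply: ge0_ler_powR; rewrite ?nnegrE ?powR_ge0 ?ltW.
have dm1 : 1 <= delta `^ (- m).
  rewrite -(powRr0 delta); apply: ger_powR; rewrite ?d0 ?d1//.
  by rewrite oppr_le0 ltW.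
apply: (@le_trans _ _ ((2 * delta) `^ a * (2 * delta `^ (- m)))).
  by rewrite ler_wpM2l ?powR_ge0//; lra.
rewrite powRM ?(ltW d0)//.
have -> : 2 `^ a * delta `^ a * (2 * delta `^ (- m)) = 2 * 2 `^ a * delta `^ b.
  have -> : delta `^ b = delta `^ a * delta `^ (- m).
    rewrite -powRD; last by rewrite (gt_eqF d0) implybT.
    by congr powR; rewrite /a /b; field.
  ring.
apply: le_trans (ler_wpM2l _ db) _; first by rewrite mulr_ge0 ?powR_ge0.
rewrite powRN powRD; last by rewrite pnatr_eq0 implybT.
rewrite (powR_mulrn 2)// le_eqVlt; apply/orP; left; apply/eqP.
by field; rewrite gt_eqF// powR_gt0.
Qed.

Lemma light_decay_gt0 delta N : 0 < light_decay delta N.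
Proof. by rewrite powR_gt0. Qed.

Lemma light_decay_le1 delta N : 0 < delta -> light_decay delta N <= 1.
Proof.
move=> d0; rewrite -(powRr0 (N ^ halvings delta).+1%:R); apply: ler_powR.
  by rewrite ler1n.
by rewrite oppr_le0 invr_ge0 ltW.
Qed.

Lemma light_decay_count delta tau N : 0 < delta -> delta <= tau ->
  (N ^ halvings delta)%:R * light_decay delta N `^ tau <= 1.
Proof.
move=> d0 dtau; rewrite /light_decay -powRrM; set q := (_ ^ _)%N.
apply: (@le_trans _ _ (q%:R * q.+1%:R `^ (-1))).
  rewrite ler_wpM2l// ler_powR ?ler1n// mulNr lerN2 mulrC.
  by rewrite ler_pdivlMr// mul1r.
by rewrite powR_inv1// ler_pdivrMr// mul1r ler_nat.
Qed.

End Constants.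

Theorem theorem3p8 (R : realType) :
  exists (delta0 : R -> R -> nat -> R -> R) (eps0 : R -> R -> nat -> R),
  forall (N : nat) (m s Lambda : R), 0 < m -> m < s -> 1 < Lambda ->
    0 < delta0 m s N Lambda /\
    forall delta : R, 0 < delta -> delta < delta0 m s N Lambda ->
      0 < eps0 delta m N /\
      forall X : metricType R, doubling X N ->
      forall mu : {outer_measure set X -> \bar R}, is_measure mu ->
      forall eps : R, 0 < eps -> eps <= eps0 delta m N ->
        ae_outer mu (fun x : X =>
          (s%:E < upper_local_dim mu x)%E ->
          ((powR delta (- m))%:E <=
             limf_esup (fun r : R => local_homogeneity delta eps r Lambda mu x) 0^'+)%E).
Proof.
exists (fun m s _ Lambda => scale_threshold m s Lambda).
exists (fun delta _ N => light_decay delta N ^+ 2) => N m s Lambda m0 ms L1.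
split=> [|delta d0 dthr]; first exact: scale_threshold_gt0.
split=> [|X dX mu [_ _ mufin] eps eps0 epse]; first by rewrite exprn_gt0// light_decay_gt0.
have [dL dtau small] := scale_thresholdP m0 ms L1 d0 dthr.
have s0 : 0 < s by exact: lt_trans ms.
pose tau := (s - m) / (2 * s).
have t0 : 0 <= tau by apply: le_trans dtau; exact: ltW.
have t1 : tau <= 1 by rewrite /tau ler_pdivrMr ?mulr_gt0//; lra.
have small' : (2 * delta) `^ (s * (1 - tau)) * (delta `^ (- m) + 1) <= 2^-1.
  by rewrite (_ : s * (1 - tau) = (s + m) / 2)// /tau; field; lra.
pose A l := [set x | (s%:E < upper_local_dim mu x)%E /\
  forall r, 0 < r -> r < l.+1%:R^-1 ->
    (local_homogeneity delta eps r Lambda mu x < (delta `^ (- m))%:E)%E].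
have A0 l : mu (A l) = 0%E.
  apply: (@null_of_small_homogeneity _ _ mu N (halvings delta) (A l) l.+1%:R^-1 delta eps Lambda
    (delta `^ (- m)) (light_decay delta N) tau s) => //.
  - exact: halvingsP.
  - exact: light_decay_gt0.
  - exact: light_decay_le1.
  - exact: ltW.
  - exact: light_decay_count.
  - exact: powR_ge0.
  - by move=> x r [_ Ax]; exact: Ax.
  - by move=> x [].
suff bad_sub : [set x | ~ ((s%:E < upper_local_dim mu x)%E ->
    ((delta `^ (- m))%:E <=
       limf_esup (fun r => local_homogeneity delta eps r Lambda mu x) 0^'+)%E)]
    `<=` \bigcup_l A l.
  apply/eqP; rewrite eq_le outer_measure_ge0 andbT -(outer_measure_bigcup_null A0).
  exact: le_outer_measure.
move=> x /not_implyP[dimx /negP]; rewrite -ltNge => homx.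
have [rho rho0 hom_rho] := limf_esup_lt_near0 homx.
exists (Num.Def.truncn rho^-1) => //; split=> // r r0 r_lt; apply: hom_rho => //.
apply: lt_trans r_lt _; rewrite invf_plt ?posrE//.
exact: truncnS_gt.
Qed.
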